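(* Let $n$ be a positive integer, let $g_1:\mathbb R\to\mathbb R$ be continuous and non-affine, and define $g_2:\mathbb R\to\mathbb R$ by $g_2(t)=1-\frac{t}{2}$. Let $\mathcal S_n$ be the smallest class of real-valued functions on $\mathbb R^n$ satisfying the following properties: (i) the coordinate functions $x_1,\dots,x_n$ belong to $\mathcal S_n$; (ii) if $u,v\in\mathcal S_n$, then $u+v\in\mathcal S_n$; (iii) if $u\in\mathcal S_n$, then $g_i\circ u\in\mathcal S_n$ for $i=1,2$. Then, for every compact set $K\subset\mathbb R^n$, the class $\mathcal S_n$ is dense in $C(K)$; that is, for every $f\in C(K)$ and every $\varepsilon>0$ there exists $F\in\mathcal S_n$ such that $\sup_{\mathbf x\in K}|f(\mathbf x)-F(\mathbf x)|<\varepsilon$.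
   Context: A function $g:\mathbb R\to\mathbb R$ is affine if it has the form $g(t)=at+b$ with $a,b\in\mathbb R$ (including constant functions), and non-affine otherwise. $C(K)$ denotes the space of real-valued continuous functions on $K$ with the uniform norm. The coordinate function $x_j$ is the map $\mathbb R^n\to\mathbb R$, $(x_1,\dots,x_n)\mapsto x_j$. Sums are pointwise. *)

(* Defs.v *)
From mathcomp Require Import all_boot all_order all_algebra.
From mathcomp Require Import all_classical all_reals all_analysis.
Import Order.TTheory GRing.Theory Num.Theory.
Import numFieldNormedType.Exports.

Set Implicit Arguments.
Unset Strict Implicit.
Unset Printing Implicit Defensive.

Local Open Scope classical_set_scope.
Local Open Scope ring_scope.

Definition affine (R : realType) (g : R -> R) : Prop :=
  exists a b : R, forall t : R, g t = a * t + b.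

Definition coordinate (R : realType) (n : nat) (j : 'I_n) : 'rV[R]_n -> R :=
  fun x => x ord0 j.

Definition superposition_closed (R : realType) (n : nat) (g1 g2 : R -> R)
    (A : set ('rV[R]_n -> R)) : Prop :=
  (forall u v, A u -> A v -> A (u \+ v)) /\
  (forall u, A u -> A (g1 \o u) /\ A (g2 \o u)).

Definition superpositions (R : realType) (n : nat) (g1 g2 : R -> R)
    : set ('rV[R]_n -> R) :=
  smallest (superposition_closed g1 g2) (range (@coordinate R n)).

(* An extended-real supremum, because the real-valued [sup] is 0 on sets that
   are not bounded above. It is -oo when K is empty. *)
Definition uniform_dist (R : realType) (n : nat) (K : set 'rV[R]_n)
    (f F : 'rV[R]_n -> R) : \bar R :=
  ereal_sup [set (`|f x - F x|)%:E | x in K].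

(* Main.v *)
Require Import Defs.
From mathcomp Require Import all_boot all_order all_algebra.
From mathcomp Require Import ring lra.
From mathcomp Require Import all_classical all_reals all_analysis.
Import Order.TTheory GRing.Theory Num.Theory.
Import numFieldNormedType.Exports.

Set Implicit Arguments.
Unset Strict Implicit.
Unset Printing Implicit Defensive.

Local Open Scope classical_set_scope.
Local Open Scope ring_scope.

(** Let A be the closure of the class in C(K).  The reflection g2 generates the
    affine operations: g2 u + g2 u = 2 - u and g2 (2 - u) = u / 2, so the class
    contains 2, 1 and -1, and it is closed under opposites and halves.  Dyadic
    multiples being uniformly dense among real multiples, A is a closed linear
    subspace of C(K) that contains the constants
    ([superpositions_opp], [superpositions_half], [closure_on_space]).

    Say that a function h on the line operates on A when h o u is in A for each
    u in A.  By uniform continuity g1 operates on A, and the continuous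
    functions operating on A form a linear space that is closed under locally
    uniform limits and under affine changes of variable.  The proof that such an
    A is all of C(K) follows de Leeuw and Katznelson.

    The key point is that t ^ 2 operates.  If g operates and G' = g, the increment
    G (t + d) - G t is a locally uniform limit of Riemann sums of translates of
    g, hence operates ([operates_increment]).  Two such averagings turn g into
    an operating C^2 function whose second derivative is the second difference
    g (t + 2 d) - 2 g (t + d) + g t.  It does not vanish for all t and d, because
    a continuous function with zero second differences is affine
    ([affine_midpoint]).  If H is operating and C^2 with H'' b <> 0, then
    (H (b + w t) + H (b - w t) - 2 H b) / w ^ 2 tends to H'' b t ^ 2 locally
    uniformly as w -> 0, so squaring operates ([operates_sqr]).

    From squaring one obtains the absolute value, as the limit of the iteration
    p -> p + (t ^ 2 - p ^ 2) / 2 ([operates_norm]).  So A is a lattice, and the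
    lattice form of the Stone-Weierstrass theorem
    ([stone_weierstrass_lattice]) concludes, since the coordinates separate
    points. *)

(** * Induction over the subsets of a compact set *)

(** Otherwise the sets B such that P holds for K minus B would form a proper
    filter containing K; near one of its cluster points, the local hypothesis
    contradicts clustering. *)
Lemma compact_induction (T : topologicalType) (K : set T) (P : set T -> Prop) :
  compact K -> P set0 ->
  (forall B C, B `<=` C -> P C -> P B) ->
  (forall B C, P B -> P C -> P (B `|` C)) ->
  (forall x, K x -> exists2 U, nbhs x U & P (U `&` K)) -> P K.
Proof.
move=> cK P0 Psub PU Ploc; apply: contrapT => nPK.
pose F : set_system T := [set B | P (K `\` B)].
have FF : ProperFilter F.
  apply: Build_ProperFilter_ex.
    move=> B FB; apply: contrapT => /set0P/negP/negPn/eqP B0.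
    by apply: nPK; rewrite -(setD0 K) -B0.
  split.
  - by rewrite /F /= setDT.
  - by move=> B C FB FC; rewrite /F /= setDIr; exact: PU.
  - by move=> B C BC; apply: Psub; exact: setDS.
have FK : F K by rewrite /F /= setDv.
have [x [Kx xcl]] := cK F FF FK.
have [U nU PU'] := Ploc _ Kx.
have FU : F (~` U) by rewrite /F /= setDE setCK setIC.
by have [y []] := xcl _ _ FU nU.
Qed.

(** * Calculus on the real line *)

Section real_functions.
Context {R : realType}.
Implicit Types g G : R -> R.

(** Only x is confined to the bounded interval: y may be the value of an
    approximation, which may leave it. *)
Lemma uniform_continuity_on_bounded g (M e : R) : continuous g -> 0 < e ->
  exists2 d, 0 < d &
    forall x y, `|x| <= M -> `|x - y| < d -> `|g x - g y| < e.
Proof.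
move=> gc e0.
suff [d d0 H] : exists2 d, 0 < d & forall x y, `[(- M), M]%classic x ->
    `|x - y| < d -> `|g x - g y| < e.
  by exists d => // x y xM; apply: H; rewrite /= in_itv /= -ler_norml.
apply: (@compact_induction _ `[(- M), M] (fun B => exists2 d, 0 < d &
  forall x y, B x -> `|x - y| < d -> `|g x - g y| < e)).
- exact: segment_compact.
- by exists 1.
- by move=> B C BC [d d0 H]; exists d => // x y /BC; exact: H.
- move=> B C [d d0 H] [d' d'0 H']; exists (Num.min d d').
    by rewrite lt_min d0.
  by move=> x y [/H|/H'] {H H'} H; rewrite lt_min => /andP[? ?]; exact: H.
- move=> x _.
  (* Half the radius of continuity at x bounds the distance from x to y and
     from y to z, so that both y and z lie in the ball where g is within e / 2
     of g x. *)
  have e2 : 0 < e / 2 by rewrite divr_gt0.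
  have /cvgrPdist_lt/(_ _ e2)/nbhs_ballP[d /= d0 H] := gc x.
  exists (ball x (d / 2)); first by apply: nbhsx_ballx; rewrite divr_gt0.
  exists (d / 2); first by rewrite divr_gt0.
  move=> y z [xy _] yz; move: xy; rewrite /ball /= => xy.
  have gy : `|g x - g y| < e / 2.
    by apply: H; rewrite /ball /=; apply: lt_le_trans xy _; lra.
  have gz : `|g x - g z| < e / 2.
    apply: H; rewrite /ball /= (_ : x - z = (x - y) + (y - z)); last by ring.
    by apply: le_lt_trans (ler_normD _ _) _; lra.
  rewrite (_ : g y - g z = (g x - g z) - (g x - g y)); last by ring.
  by apply: le_lt_trans (ler_normB _ _) _; lra.
Qed.

Lemma is_derive_continuous G g :
  (forall x : R, is_derive x 1 G (g x)) -> continuous G.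
Proof.
by move=> dG x; have [+ _] := dG x => /derivable1_diffP/differentiable_continuous.
Qed.

(** The position of c is given relative to x, so that x and y may come in either
    order. *)
Lemma mean_value G g x y : (forall x : R, is_derive x 1 G (g x)) ->
  exists2 c, `|c - x| <= `|y - x| & G y - G x = g c * (y - x).
Proof.
move=> dG; have cG := is_derive_continuous dG.
have [xy|/ltW yx] := leP x y.
  have [|c] := @MVT_segment R G g x y xy (fun z _ => dG z).
    exact: continuous_subspaceT.
  by rewrite in_itv /= => /andP[xc cy] ->; exists c => //; rewrite !ger0_norm; lra.
have [|c] := @MVT_segment R G g y x yx (fun z _ => dG z).
  exact: continuous_subspaceT.
rewrite in_itv /= => /andP[yc cx] E; exists c; last by lra.
by rewrite !ler0_norm; lra.
Qed.

(** Integrating from minus infinity, rather than from 0, makes the fundamental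
    theorem of calculus available at every point, 0 included. *)
Lemma primitive_of_vanishing_left g : continuous g -> (forall x, x <= 0 -> g x = 0) ->
  exists G, forall x : R, is_derive x 1 G (g x).
Proof.
move=> gc g0.
exists (fun x => \int[lebesgue_measure]_(t in `]-oo, x]) g t) => x.
have [] // := @continuous_FTC1 R g -oo%O x (x + 1) _ _ _ (gc x).
- by rewrite ltrDl.
- have I : lebesgue_measure.-integrable (`]-oo, x + 1] `&` `[0, x + 1]) (EFin \o g).
    rewrite setIidr; last by move=> t; rewrite /= !in_itv /= => /andP[].
    apply: continuous_compact_integrable; first exact: segment_compact.
    exact: continuous_subspaceT.
  apply: (@eq_integrable _ _ _ lebesgue_measure _ _ ((EFin \o g) \_ `[0, x + 1])).
  - exact: measurable_itv.
  - move=> t; rewrite inE /= in_itv /= => tx.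
    rewrite patchE; case: ifPn => //; rewrite notin_setE /= in_itv /= tx andbT.
    by move=> /negP; rewrite -ltNge => /ltW /g0 ->.
  - by apply/integrable_restrict => //; exact: measurable_itv.
- by rewrite ltNyr.
by move=> d E; split => //; rewrite -E derive1E.
Qed.

Lemma is_derive_increment G g (d x : R) : (forall x : R, is_derive x 1 G (g x)) ->
  is_derive x 1 (fun t => G (t + d) - G t) (g (x + d) - g x).
Proof.
by move=> dG; apply: is_derive_eq; rewrite /GRing.scale /= addr0 mulr1.
Qed.

(** The line is cut at 0: g x = g (max x 0) + g (- max (- x) 0) - g 0, where the
    first two terms are, up to constants and the symmetry x -> - x, functions
    that vanish on a half line. *)
Lemma primitive_exists g : continuous g ->
  exists G, forall x : R, is_derive x 1 G (g x).
Proof.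
move=> gc.
have half h : continuous h ->
    exists G : R -> R, forall x : R, is_derive x 1 G (h (Num.max x 0) - h 0).
  move=> hc; apply: primitive_of_vanishing_left; last first.
    by move=> x x0; rewrite (max_idPr x0) subrr.
  have hm : continuous (h \o (fun x : R => Num.max x 0)).
    move=> x; apply: continuous_comp; last exact: hc.
    by apply: continuous_max => //; exact: cst_continuous.
  by move=> x; apply: continuousB; [exact: hm|exact: cst_continuous].
have [F dF] := half g gc.
have [|F' dF'] := half (fun x => g (- x)).
  by move=> x; apply: continuous_comp; [exact: opp_continuous | exact: gc].
exists (fun x => F x - F' (- x) + g 0 * x) => x.
apply: is_derive_eq; rewrite /GRing.scale /= !mulr1 oppr0 mulrN1 opprK.
have [x0|x0] := leP 0 x; first by rewrite max_r ?oppr_le0// oppr0; ring.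
by rewrite max_l ?opprK ?oppr_ge0 ?ltW//; ring.
Qed.

(** Integrating the midpoint identity over s in [0, 1] writes 2 g x as the integral
    of g over [x - 1, x + 1].  Hence g has derivative (g (x + 1) - g (x - 1)) / 2,
    and the midpoint identity around x / 2 shows that this is constant. *)
Lemma affine_midpoint g : continuous g ->
  (forall x s, g (x + s) + g (x - s) = 2 * g x) -> affine g.
Proof.
move=> gc mid; have [G dG] := primitive_exists gc.
have gE x : g x = (G (x + 1) - G (x - 1)) / 2.
  pose p s := G (x + s) - G (x - s) - 2 * g x * s.
  have dp (s : R) : is_derive s 1 p 0.
    apply: is_derive_eq; rewrite /GRing.scale /=.
    by rewrite -(mid x s); ring.
  have := is_derive_0_is_cst 1 0 dp; rewrite /p mulr1 mulr0 addr0 !subr0.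
  by rewrite subrr => E; lra.
pose a := (g 1 - g (-1)) / 2.
have dg (x : R) : is_derive x 1 g a.
  have -> : g = fun x => 2^-1 * (G (x + 1) - G (x - 1)).
    by apply/funext => y; rewrite gE mulrC.
  apply: is_derive_eq.
  rewrite /GRing.scale /= /a.
  have := mid (x / 2) (x / 2 + 1); have := mid (x / 2) (x / 2 - 1).
  rewrite (_ : x / 2 + (x / 2 + 1) = x + 1); last by field.
  rewrite (_ : x / 2 - (x / 2 + 1) = -1); last by field.
  rewrite (_ : x / 2 + (x / 2 - 1) = x - 1); last by field.
  rewrite (_ : x / 2 - (x / 2 - 1) = 1); last by field.
  by move=> E1 E2; lra.
exists a, (g 0) => x.
have dp (s : R) : is_derive s 1 (fun x => g x - a * x) 0.
  by apply: is_derive_eq; rewrite /GRing.scale /= mulr1 subrr.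
by have /= := is_derive_0_is_cst x 0 dp; rewrite mulr0 subr0 => <-; ring.
Qed.

(** D contains the dyadic numbers. *)
Lemma halving_subgroup_dense (D : set R) : D 1 ->
  (forall x y, D x -> D y -> D (x + y)) -> (forall x, D x -> D (- x)) ->
  (forall x, D x -> D (x / 2)) ->
  forall c e, 0 < e -> exists2 q, D q & `|c - q| < e.
Proof.
move=> D1 DD DN Dh c e e0.
have D0 : D 0 by rewrite -(subrr 1); exact/DD/DN.
have D2 k : D (2^-1 ^+ k).
  by elim: k => [|k IH]; rewrite ?expr0 // exprSr; exact: Dh.
have DM x (m : nat) : D x -> D (x *+ m).
  by move=> Dx; elim: m => [|m IH]; rewrite ?mulr0n // mulrS; exact: DD.
have DZ x (m : int) : D x -> D (x *~ m).
  by move=> Dx; case: m => m; [exact: DM|rewrite NegzE mulrNz; exact/DN/DM].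
have [k ke] : exists k, 2^-1 ^+ k < e.
  have h1 : `|2^-1 : R| < 1 by rewrite ger0_norm; lra.
  have /cvgrPdist_lt/(_ _ e0)[N _ H] := cvg_expr h1.
  exists N; have := H N (leqnn N).
  by rewrite /= sub0r normrN ger0_norm ?exprn_ge0.
have p0 : 0 < (2^-1 : R) ^+ k by rewrite exprn_gt0 // invr_gt0.
exists (2^-1 ^+ k *~ Num.floor (c / 2^-1 ^+ k)); first exact: DZ.
have := floor_itv (c / 2^-1 ^+ k) => /andP[].
rewrite intrD /= ler_pdivlMr // ltr_pdivrMr // => lo hi.
by rewrite -mulrzr mulrC ger0_norm; lra.
Qed.

(** The increment telescopes over the subdivision, and by the mean value theorem
    each small increment is h times a value of g at distance at most h from the
    sampling point. *)
Lemma increment_riemann_sum G g (d M e : R) :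
  continuous g -> (forall x : R, is_derive x 1 G (g x)) -> 0 < e ->
  exists N, forall t, `|t| <= M ->
    `|G (t + d) - G t -
      \sum_(i < N.+1) d / N.+1%:R * g (t + d / N.+1%:R * i%:R)| <= e.
Proof.
move=> gc dG e0.
pose e' := e / (`|d| + 1).
have d1 : 0 < `|d| + 1 by rewrite ltr_wpDl.
have e'0 : 0 < e' by rewrite divr_gt0.
have [r r0 H] := uniform_continuity_on_bounded (M + `|d|) gc e'0.
pose N := Num.trunc (`|d| / r); exists N => t tM.
set h := d / N.+1%:R.
have N0 : (0 : R) < N.+1%:R by [].
have hr : `|h| < r.
  rewrite /h normrM normfV (ger0_norm (ltW N0)) ltr_pdivrMr // mulrC -ltr_pdivrMr //.
  exact: truncnS_gt.
have hE : N.+1%:R * h = d by rewrite /h mulrC divfK // gt_eqF.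
have -> : G (t + d) - G t = \sum_(i < N.+1) (G (t + h * i.+1%:R) - G (t + h * i%:R)).
  rewrite -(big_mkord xpredT (fun i => G (t + h * i.+1%:R) - G (t + h * i%:R))).
  by rewrite (telescope_sumr (fun i => G (t + h * i%:R))) // mulr0 addr0 mulrC hE.
rewrite -sumrB; apply: le_trans (ler_norm_sum _ _ _) _.
apply: le_trans (_ : \sum_(i < N.+1) `|h| * e' <= _).
  apply: ler_sum => i _.
  have [c cx ->] := mean_value (t + h * i%:R) (t + h * i.+1%:R) dG.
  have E : t + h * i.+1%:R - (t + h * i%:R) = h by rewrite -natr1; ring.
  rewrite E in cx *; rewrite mulrC -mulrBr normrM ler_wpM2l // ltW //.
  rewrite distrC; apply: H; last by rewrite distrC; apply: le_lt_trans hr.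
  apply: le_trans (ler_normD _ _) _; apply: lerD => //.
  rewrite -hE !normrM !(ger0_norm (ler0n _ _)) mulrC.
  by rewrite ler_wpM2r // ler_nat ltnW.
rewrite sumr_const card_ord -mulr_natl mulrA.
rewrite -[X in X * _ * _](@ger0_norm _ N.+1%:R) // -normrM hE /e'.
by rewrite mulrA ler_pdivrMr // mulrC ler_pM2l // lerDl.
Qed.

(** The second-order Taylor formula for the even part of G at b, uniform in t since
    only the product w t matters. *)
Lemma second_difference_limit G G1 G2 (b M e : R) :
  (forall x : R, is_derive x 1 G (G1 x)) ->
  (forall x : R, is_derive x 1 G1 (G2 x)) ->
  {for b, continuous G2} -> 0 < e ->
  exists2 w, 0 < w & forall t, `|t| <= M ->
    `|G2 b * t ^+ 2 - w ^- 2 * (G (b + w * t) + G (b - w * t) - 2 * G b)| <= e.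
Proof.
move=> dG dG1 cG2 e0.
pose m := Num.max M 1; have m0 : 0 < m by rewrite lt_max ltr01 orbT.
pose e' := e / (2 * m ^+ 2).
have e'0 : 0 < e' by rewrite divr_gt0 // mulr_gt0 // exprn_gt0.
have /cvgrPdist_lt/(_ _ e'0)/nbhs_ballP[r /= r0 H] := cG2.
(* The points where G2 is sampled lie within 3 |w t| of b; the choice of w keeps
   3 w m below the radius r. *)
pose w := r / (4 * m); have w0 : 0 < w by rewrite divr_gt0 // mulr_gt0.
exists w => // t tM; have tm : `|t| <= m by rewrite (le_trans tM) // le_max lexx.
(* With the quadratic term removed, the mean value theorem applied to p and then
   to G1 leaves only the oscillation of G2 near b. *)
pose p s := G (b + s) + G (b - s) - s ^+ 2 * G2 b.
have dp (s : R) : is_derive s 1 p (G1 (b + s) - G1 (b - s) - 2 * s * G2 b).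
  by apply: is_derive_eq; rewrite /GRing.scale /=; ring.
set s := w * t.
have st : `|s| <= w * m by rewrite normrM (ger0_norm (ltW w0)) ler_pM2l.
have wm : w * m = r / 4 by rewrite /w; field; rewrite gt_eqF.
have [c cs pE] := mean_value 0 s dp.
rewrite !subr0 in cs pE.
have [c' c'b GE] := mean_value (b - c) (b + c) dG1.
have G2c' : `|G2 b - G2 c'| < e'.
  apply: H; rewrite /ball /=.
  have : `|b + c - (b - c)| <= 2 * `|c|.
    by rewrite (_ : b + c - (b - c) = 2 * c); [rewrite normrM ger0_norm | ring].
  have : `|b - c'| <= `|c' - (b - c)| + `|c|.
    rewrite (_ : b - c' = - (c' - (b - c)) + c); last by ring.
    by apply: le_trans (ler_normD _ _) _; rewrite normrN.
  lra.
have -> : G2 b * t ^+ 2 - w ^- 2 * (G (b + s) + G (b - s) - 2 * G b) =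
   (2 * (c * s) * (G2 b - G2 c')) / w ^+ 2.
  have -> : G (b + s) + G (b - s) - 2 * G b = p s - p 0 + s ^+ 2 * G2 b.
    by rewrite /p addr0 subr0; ring.
  rewrite pE GE /s; field; by rewrite gt_eqF.
rewrite normrM normfV [X in _ / X]ger0_norm ?exprn_ge0 ?(ltW w0)//.
rewrite ler_pdivrMr ?exprn_gt0// (normrM (2 * _)) (normrM 2) (normrM c) ger0_norm//.
have cs2 : `|c| * `|s| <= (w * m) ^+ 2.
  by rewrite expr2 ler_pM // (le_trans cs).
have -> : e * w ^+ 2 = 2 * (w * m) ^+ 2 * e'.
  by rewrite /e'; field; rewrite gt_eqF.
by apply: ler_pM; rewrite ?mulr_ge0 ?ler_pM2l ?(ltW G2c').
Qed.

(** With a = |t|, the iteration q -> q + (t ^ 2 - q ^ 2) / 2 multiplies the error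
    a - q by 1 - (a + q) / 2.  While q >= 0 this factor is at most
    1 - (a - q) / 2, and x -> x (1 - x / 2) is increasing on [0, 1] and maps
    2 / K below 2 / (K + 1). *)
Lemma abs_iteration_step (a q : R) (k : nat) :
  0 <= a <= 1 -> 0 <= a - q <= a -> a - q <= 2 / k.+2%:R ->
  let q' := q + (a ^+ 2 - q ^+ 2) / 2 in
  0 <= a - q' <= a /\ a - q' <= 2 / k.+3%:R.
Proof.
move=> /andP[a0 a1] /andP[lo hi] IH /=.
have -> : a - (q + (a ^+ 2 - q ^+ 2) / 2) = (a - q) * (1 - (a + q) / 2) by field.
split.
  apply/andP; split; first by rewrite mulr_ge0 //; lra.
  by apply: (le_trans _ hi); rewrite ler_piMr //; lra.
apply: le_trans (_ : (a - q) * (1 - (a - q) / 2) <= _).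
  by rewrite ler_wpM2l //; lra.
rewrite -(natr1 k.+2); have : (2 : R) <= k.+2%:R by rewrite ler_nat.
move: (k.+2%:R) IH => K IH K2.
have K1 : 2 / K <= 1 by rewrite ler_pdivrMr; lra.
apply: le_trans (_ : 2 / K * (1 - 2 / K / 2) <= _).
  have : 0 <= (2 / K - (a - q)) * (1 - (2 / K + (a - q)) / 2).
    by rewrite mulr_ge0; lra.
  by move: (2 / K) => y; lra.
rewrite -subr_ge0.
have -> : 2 / (K + 1) - 2 / K * (1 - 2 / K / 2) = 2 / (K ^+ 2 * (K + 1)).
  by field; apply/andP; split; lra.
by rewrite divr_ge0 // mulr_ge0 ?exprn_ge0//; lra.
Qed.

End real_functions.

(** * Functions operating on a closed space of functions *)

Section operating_functions.
Context {R : realType} {T : topologicalType}.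

Lemma within_continuous_postcomp (K : set T) (u : T -> R) (g : R -> R) :
  {within K, continuous u} -> continuous g ->
  {within K, continuous (fun x => g (u x))}.
Proof. by move=> uc gc x; apply: continuous_comp; [exact: uc | exact: gc]. Qed.

Lemma bounded_within (K : set T) (u : T -> R) :
  compact K -> {within K, continuous u} -> exists M, forall x, K x -> `|u x| <= M.
Proof.
move=> cK cu; have [M [_ H]] := compact_bounded (continuous_compact cu cK).
by exists (M + 1) => x Kx; apply: (H (M + 1)); [rewrite ltrDl | exists x].
Qed.

(** The closed linear subspaces of C(K) that contain the constants, encoded by
    functions on the whole space: by [space_closed], membership depends only on
    the restriction to K. *)
Record closed_function_space (K : set T) (A : set (T -> R)) : Prop := {
  space_continuous : forall u, A u -> {within K, continuous u};
  space_one : A (cst 1);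
  space_add : forall u v, A u -> A v -> A (fun x => u x + v x);
  space_scale : forall c u, A u -> A (fun x => c * u x);
  space_closed : forall u, {within K, continuous u} ->
    (forall e, 0 < e -> exists2 v, A v & forall x, K x -> `|u x - v x| <= e) ->
    A u }.

Definition operates (A : set (T -> R)) (g : R -> R) : Prop :=
  forall u, A u -> A (fun x => g (u x)).

Variables (K : set T) (A : set (T -> R)).
Hypotheses (K_compact : compact K) (A_space : closed_function_space K A).

Lemma space_cst c : A (fun=> c).
Proof.
have := space_scale A_space c (space_one A_space).
by congr (A _); apply/funext => x; rewrite /= mulr1.
Qed.

Lemma space_sub u v : A u -> A v -> A (fun x => u x - v x).
Proof.
move=> Au Av; have := space_add A_space Au (space_scale A_space (-1) Av).
by congr (A _); apply/funext => x; rewrite mulN1r.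
Qed.

Lemma operates_add g h : operates A g -> operates A h ->
  operates A (fun t => g t + h t).
Proof. by move=> og oh u Au; exact: (space_add A_space (og _ Au)) (oh _ Au). Qed.

Lemma operates_sub g h : operates A g -> operates A h ->
  operates A (fun t => g t - h t).
Proof. by move=> og oh u Au; exact: space_sub (og _ Au) (oh _ Au). Qed.

Lemma operates_scale c g : operates A g -> operates A (fun t => c * g t).
Proof. by move=> og u Au; exact: (space_scale A_space c (og _ Au)). Qed.

Lemma operates_comp_affine a b g : operates A g -> operates A (fun t => g (a * t + b)).
Proof.
move=> og u Au; apply: og.
exact: (space_add A_space (space_scale A_space a Au) (space_cst b)).
Qed.

Lemma operates_sum n (g : 'I_n -> R -> R) : (forall i, operates A (g i)) ->
  operates A (fun t => \sum_(i < n) g i t).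
Proof.
elim: n g => [|n IH] g og u Au.
  by under eq_fun do rewrite big_ord0; exact: space_cst.
under eq_fun do rewrite big_ord_recl.
by apply: (space_add A_space); [exact: og | exact: (IH (fun i => g (lift ord0 i)))].
Qed.

(** A function in A has its values in a bounded interval, since K is compact:
    locally uniform approximation of g is enough. *)
Lemma operates_closed g : continuous g ->
  (forall M e, 0 < e -> exists2 h, operates A h &
     forall t, `|t| <= M -> `|g t - h t| <= e) -> operates A g.
Proof.
move=> gc H u Au; have uc := space_continuous A_space Au.
apply: (space_closed A_space); first exact: within_continuous_postcomp.
move=> e e0; have [M uM] := bounded_within K_compact uc.
have [h oh gh] := H M e e0.
by exists (fun x => h (u x)); [exact: oh | move=> x Kx; exact/gh/uM].
Qed.

Lemma operates_increment g G d : continuous g ->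
  (forall x : R, is_derive x 1 G (g x)) -> operates A g ->
  operates A (fun t => G (t + d) - G t).
Proof.
move=> gc dG og.
have dI (x : R) := is_derive_increment d x dG.
apply: operates_closed; first exact: is_derive_continuous dI.
move=> M e e0; have [N H] := increment_riemann_sum d M gc dG e0.
eexists; last exact: H.
apply: operates_sum => i; apply: operates_scale.
by under eq_fun do rewrite -[X in X + _]mul1r; exact: operates_comp_affine.
Qed.

(** The quotients of [second_difference_limit] are linear combinations of a constant
    and of affine changes of variable of G. *)
Lemma operates_sqr_of_C2 G G1 G2 b :
  (forall x : R, is_derive x 1 G (G1 x)) ->
  (forall x : R, is_derive x 1 G1 (G2 x)) ->
  {for b, continuous G2} -> G2 b != 0 -> operates A G ->
  operates A (fun t => t ^+ 2).
Proof.
move=> dG dG1 cG2 nz oG.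
suff /(operates_scale (G2 b)^-1) : operates A (fun t => G2 b * t ^+ 2).
  by under eq_fun do rewrite mulKf //.
apply: operates_closed.
  move=> x; apply: (@continuous_comp _ _ _ (fun t : R => t ^+ 2) (fun t => G2 b * t)).
    exact: exprn_continuous.
  exact: mulrl_continuous.
move=> M e e0; have [w w0 lim] := second_difference_limit M dG dG1 cG2 e0.
eexists; last exact: lim.
apply: operates_scale; apply: operates_sub; first apply: operates_add.
- by under eq_fun do rewrite addrC; exact: operates_comp_affine.
- by under eq_fun do rewrite addrC -mulNr; exact: operates_comp_affine.
- by move=> u Au; exact: space_cst.
Qed.

(** Taking the increment of a primitive twice smooths g while keeping it an
    operating function; the second derivative of the result is a second
    difference of g, nonzero somewhere by [affine_midpoint]. *)
Lemma operates_sqr g : continuous g -> ~ affine g -> operates A g ->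
  operates A (fun t => t ^+ 2).
Proof.
move=> gc nag og.
pose G2 d x := g (x + d + d) - g (x + d) - (g (x + d) - g x).
have [b [d nz]] : exists b d, G2 d b != 0.
  apply: contrapT => nz; apply/nag/affine_midpoint => // x s.
  have [//|/eqP ne] := pselect (g (x + s) + g (x - s) = 2 * g x).
  exfalso; apply: nz; exists (x - s), s; apply: contra ne => /eqP.
  by rewrite /G2 subrK => E; apply/eqP; lra.
have [F dF] := primitive_exists gc.
have [H dH] := primitive_exists (is_derive_continuous dF).
have dI (x : R) := is_derive_increment d x dF.
have dI2 (x : R) := is_derive_increment d x dH.
have oG := operates_increment d (is_derive_continuous dI) dI2
  (operates_increment d gc dF og).
have dG (x : R) := is_derive_increment d x dI2.
have dG1 (x : R) := is_derive_increment d x dI.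
apply: (operates_sqr_of_C2 dG dG1 _ nz oG).
have gd : continuous (fun x => g (x + d)).
  move=> x; apply: (@continuous_comp _ _ _ (fun x => x + d) g); last exact: gc.
  by apply: continuousD => //; exact: cst_continuous.
have gdd : continuous (fun x => g (x + d + d)).
  move=> x.
  apply: (@continuous_comp _ _ _ (fun x => x + d) (fun x => g (x + d)));
    last exact: gd.
  by apply: continuousD => //; exact: cst_continuous.
by apply: continuousB; apply: continuousB;
  [exact: gdd | exact: gd | exact: gd | exact: gc].
Qed.

(** The square root of t ^ 2, by an iteration that uses only squares and linear
    combinations; its error on [-1, 1] at step k is at most 2 / (k + 2). *)
Lemma operates_norm : operates A (fun t => t ^+ 2) -> operates A (fun t => `|t|).
Proof.
move=> osq.
pose p := fix p k t : R :=
  if k is k'.+1 then p k' t + (t ^+ 2 - p k' t ^+ 2) / 2 else 0.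
have op k : operates A (p k).
  elim: k => [|k IH]; first by move=> u Au; exact: space_cst.
  have -> : p k.+1 = fun t => p k t + 2^-1 * (t ^+ 2 - p k t ^+ 2).
    by apply/funext => t /=; rewrite mulrC.
  apply: operates_add => //; apply: operates_scale; apply: operates_sub => //.
  by move=> u Au; exact/osq/IH.
have pP k t : `|t| <= 1 -> 0 <= `|t| - p k t <= `|t| /\ `|t| - p k t <= 2 / k.+2%:R.
  move=> t1; elim: k => [|k [/andP[lo hi] IH]] /=.
    by rewrite subr0 normr_ge0 lexx; split => //; rewrite divff.
  rewrite -(real_normK (num_real t)).
  by apply: abs_iteration_step; rewrite ?normr_ge0 ?lo.
apply: operates_closed; first exact: norm_continuous.
move=> M e e0; pose m := Num.max M 1.
have m0 : 0 < m by rewrite lt_max ltr01 orbT.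
pose k := Num.trunc (2 * m / e).
exists (fun t => m * p k (m^-1 * t + 0)).
  by apply: operates_scale; exact: operates_comp_affine.
move=> t tM; rewrite addr0.
have tm : `|m^-1 * t| <= 1.
  rewrite normrM normfV (gtr0_norm m0) mulrC ler_pdivrMr // mul1r.
  by rewrite (le_trans tM) // le_max lexx.
have [/andP[lo _] hi] := pP k _ tm.
have -> : `|t| = m * `|m^-1 * t|.
  by rewrite normrM normfV (gtr0_norm m0) mulVKf // gt_eqF.
rewrite -mulrBr ger0_norm; last by rewrite mulr_ge0 // ltW.
apply: le_trans (ler_wpM2l (ltW m0) hi) _.
rewrite mulrA ler_pdivrMr // mulrC [leRHS]mulrC -ler_pdivrMr // ltW //.
apply: lt_le_trans (truncnS_gt _) _.
by rewrite ler_nat.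
Qed.

End operating_functions.

(** * The Stone-Weierstrass theorem *)

Section stone_weierstrass.
Context {R : realType} {T : topologicalType}.
Variables (K : set T) (A : set (T -> R)).
Hypotheses (K_compact : compact K) (A_space : closed_function_space K A).

Lemma close_near (u v : T -> R) y e :
  {within K, continuous u} -> {within K, continuous v} -> K y -> u y = v y ->
  0 < e -> exists2 U, nbhs y U & forall z, U z -> K z -> `|u z - v z| < e.
Proof.
move=> uc vc Ky uv e0.
have dc : {within K, continuous (fun z => u z - v z)}.
  by move=> z; apply: continuousB; [exact: uc | exact: vc].
have /cvgrPdist_lt/(_ _ e0) := (subspace_continuousP K _).1 dc y Ky.
move=> H; exists [set z | K z -> `|u z - v z| < e] => //.
apply: (@filterS _ (nbhs y)) H => z H Kz; have := H Kz.
by rewrite /from_subspace uv subrr sub0r normrN.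
Qed.

Section lattice.
Hypothesis A_norm : operates A (fun t => `|t|).

Lemma space_max u v : A u -> A v -> A (fun x => Num.max (u x) (v x)).
Proof.
move=> Au Av; under eq_fun do rewrite maxr_absE mulrC.
apply: (space_scale A_space); apply: (space_add A_space).
  exact: (space_add A_space).
exact: A_norm (space_sub A_space Au Av).
Qed.

Lemma space_min u v : A u -> A v -> A (fun x => Num.min (u x) (v x)).
Proof.
move=> Au Av; under eq_fun do rewrite minr_absE mulrC.
apply: (space_scale A_space); apply: (space_sub A_space).
  exact: (space_add A_space).
exact: A_norm (space_sub A_space Au Av).
Qed.

(** The usual two-stage argument, each stage by [compact_induction]: maxima of
    functions that interpolate f at x and at a second point give functions of A
    that equal f at x and lie above f - e; minima of these lie below f + e as
    well. *)
Lemma stone_weierstrass_lattice f :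
  (forall x y, K x -> K y -> x <> y -> exists2 u, A u & u x <> u y) ->
  {within K, continuous f} -> A f.
Proof.
move=> sep fc; apply: (space_closed A_space fc) => e e0.
have interpolate x y : K x -> K y -> exists2 u, A u & u x = f x /\ u y = f y.
  move=> Kx Ky; have [->|xy] := pselect (x = y).
    by exists (fun=> f y) => //; exact: (space_cst A_space).
  have [u Au /eqP uxy] := sep _ _ Kx Ky xy.
  exists (fun z => (f y - f x) / (u y - u x) * (u z - u x) + f x).
    apply: (space_add A_space); last exact: (space_cst A_space).
    apply: (space_scale A_space); apply: (space_sub A_space) => //.
    exact: (space_cst A_space).
  split; first by rewrite subrr mulr0 add0r.
  by rewrite divfK ?subrK // subr_eq0 eq_sym.
have above x : K x -> exists2 v, A v & v x = f x /\ forall z, K z -> f z - e < v z.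
  move=> Kx; apply: (@compact_induction _ K (fun B => exists2 v, A v &
    v x = f x /\ forall z, B z -> f z - e < v z)) => //.
  - by exists (fun=> f x); [exact: (space_cst A_space) | split].
  - by move=> B C BC [v Av [vx vf]]; exists v => //; split => // z /BC; exact: vf.
  - move=> B C [v Av [vx vf]] [w Aw [wx wf]].
    exists (fun z => Num.max (v z) (w z)); first exact: space_max.
    split; first by rewrite vx wx maxxx.
    by move=> z [/vf|/wf] H; rewrite lt_max H ?orbT.
  - move=> y Ky; have [u Au [ux uy]] := interpolate x y Kx Ky.
    have [U nU H] := close_near fc (space_continuous A_space Au) Ky (esym uy) e0.
    exists U => //; exists u => //; split => // z [Uz Kz].
    by have := H z Uz Kz; rewrite ltr_norml => /andP[]; lra.
suff [v Av [vlo vhi]] : exists2 v, A v &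
    (forall z, K z -> f z - e < v z) /\ (forall z, K z -> v z < f z + e).
  exists v => // z Kz; rewrite ler_norml.
  by have := vlo z Kz; have := vhi z Kz; move=> *; apply/andP; split; lra.
apply: (@compact_induction _ K (fun B => exists2 v, A v &
    (forall z, K z -> f z - e < v z) /\ (forall z, B z -> v z < f z + e))) => //.
- have [M fM] := bounded_within K_compact fc.
  exists (fun=> M); first exact: (space_cst A_space).
  by split => // z /fM; rewrite ler_norml => /andP[]; lra.
- by move=> B C BC [v Av [vlo vhi]]; exists v => //; split => // z /BC; exact: vhi.
- move=> B C [v Av [vlo vhi]] [w Aw [wlo whi]].
  exists (fun z => Num.min (v z) (w z)); first exact: space_min.
  split; first by move=> z Kz; rewrite lt_min vlo ?wlo.
  by move=> z [/vhi|/whi] H; rewrite gt_min H ?orbT.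
- move=> x Kx; have [v Av [vx vlo]] := above x Kx.
  have [U nU H] := close_near (space_continuous A_space Av) fc Kx vx e0.
  exists U => //; exists v => //; split => // z [Uz Kz].
  by have := H z Uz Kz; rewrite ltr_norml => /andP[]; lra.
Qed.

End lattice.

(** The theorem of de Leeuw and Katznelson. *)
Theorem operating_nonaffine_dense g f : continuous g -> ~ affine g -> operates A g ->
  (forall x y, K x -> K y -> x <> y -> exists2 u, A u & u x <> u y) ->
  {within K, continuous f} -> A f.
Proof.
move=> gc nag og; apply: stone_weierstrass_lattice.
apply: (operates_norm K_compact A_space).
exact: (operates_sqr K_compact A_space gc nag og).
Qed.

End stone_weierstrass.

(** * The uniform closure of a class of functions *)

Section closure_of_a_class.
Context {R : realType} {T : topologicalType}.
Variables (K : set T) (S : set (T -> R)).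
Hypothesis K_compact : compact K.

Definition closure_on : set (T -> R) := [set u | {within K, continuous u} /\
  forall e, 0 < e -> exists2 v, S v & forall x, K x -> `|u x - v x| < e].

Lemma sub_closure_on u : S u -> {within K, continuous u} -> closure_on u.
Proof. by move=> Su uc; split => // e e0; exists u => // x _; rewrite subrr normr0. Qed.

Lemma closure_on_closed u : {within K, continuous u} ->
  (forall e, 0 < e -> exists2 v, closure_on v & forall x, K x -> `|u x - v x| <= e) ->
  closure_on u.
Proof.
move=> uc H; split => // e e0.
have e2 : 0 < e / 2 by rewrite divr_gt0.
have [v [_ vS] uv] := H _ e2; have [w Sw vw] := vS _ e2.
exists w => // x Kx; rewrite (_ : u x - w x = (u x - v x) + (v x - w x)); last by ring.
by have := uv x Kx; have := vw x Kx; have := ler_normD (u x - v x) (v x - w x); lra.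
Qed.

Lemma closure_on_add u v : (forall u v, S u -> S v -> S (u \+ v)) ->
  closure_on u -> closure_on v -> closure_on (fun x => u x + v x).
Proof.
move=> SD [uc uS] [vc vS]; split.
  by move=> x; apply: continuousD; [exact: uc | exact: vc].
move=> e e0; have e2 : 0 < e / 2 by rewrite divr_gt0.
have [u' Su uu] := uS _ e2; have [v' Sv vv] := vS _ e2.
exists (u' \+ v'); first exact: SD.
move=> x Kx /=.
rewrite (_ : u x + v x - (u' x + v' x) = (u x - u' x) + (v x - v' x)); last by ring.
have := uu x Kx; have := vv x Kx; have := ler_normD (u x - u' x) (v x - v' x); lra.
Qed.

Lemma closure_on_operates g : continuous g -> (forall u, S u -> S (g \o u)) ->
  operates closure_on g.
Proof.
move=> gc Sg u [uc uS]; split; first exact: within_continuous_postcomp.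
move=> e e0; have [M uM] := bounded_within K_compact uc.
have [d d0 H] := uniform_continuity_on_bounded M gc e0.
have [v Sv uv] := uS _ d0; exists (g \o v); first exact: Sg.
by move=> x Kx; apply: H; [exact: uM | exact: uv].
Qed.

(** The real scalars: if u is in the closure, the q such that q u is in it form a
    subgroup of the line containing 1 and closed under halving, hence dense; and
    q u tends to c u uniformly on K as q tends to c, because u is bounded
    there. *)
Lemma closure_on_space :
  (forall u v, S u -> S v -> S (u \+ v)) ->
  (forall u, S u -> S (fun x => - u x)) ->
  (forall u, S u -> S (fun x => u x / 2)) ->
  S (cst 1) -> closed_function_space K closure_on.
Proof.
move=> SD SN Sh S1.
have AN u : closure_on u -> closure_on (fun x => - u x).
  by apply: (@closure_on_operates (fun t => - t)) => //; exact: opp_continuous.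
have Ah u : closure_on u -> closure_on (fun x => u x / 2).
  by apply: (@closure_on_operates (fun t => t / 2)) => //; exact: mulrr_continuous.
split.
- by move=> u [].
- by apply: sub_closure_on => // x; exact: cst_continuous.
- by move=> u v; exact: closure_on_add.
- move=> c u Au; apply: closure_on_closed.
    apply: (@within_continuous_postcomp _ _ K u (fun t => c * t)); first exact: Au.1.
    exact: mulrl_continuous.
  move=> e e0; have [M uM] := bounded_within K_compact Au.1.
  pose D := [set q | closure_on (fun x => q * u x)].
  have M1 : 0 < `|M| + 1 by rewrite ltr_wpDl.
  have eM : 0 < e / (`|M| + 1) by rewrite divr_gt0.
  have [] := @halving_subgroup_dense R D _ _ _ _ c _ eM.
  + by rewrite /D /=; under eq_fun do rewrite mul1r.
  + move=> p q Dp Dq; rewrite /D /=; under eq_fun do rewrite mulrDl.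
    exact: closure_on_add.
  + by move=> p Dp; rewrite /D /=; under eq_fun do rewrite mulNr; exact: AN.
  + by move=> p Dp; rewrite /D /=; under eq_fun do rewrite mulrAC; exact: Ah.
  + move=> q Dq cq; exists (fun x => q * u x) => // x Kx.
    rewrite -mulrBl normrM; have := uM x Kx; have := ler_norm M.
    move=> MM ux; apply: le_trans (_ : e / (`|M| + 1) * (`|M| + 1) <= _).
      by rewrite ler_pM // ?ltW //; lra.
    by rewrite divfK // gt_eqF.
- exact: closure_on_closed.
Qed.

End closure_of_a_class.

(** * The superposition class *)

Section superpositions.
Context {R : realType} {n : nat}.
Variable g : R -> R.
Local Notation S := (@superpositions R n g (fun t : R => 1 - t / 2)).

Lemma superpositions_coordinate j : S (coordinate j).
Proof. by move=> B [_ subB]; apply: subB; exists j. Qed.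

Lemma superpositions_add u v : S u -> S v -> S (u \+ v).
Proof. by move=> Su Sv B SB; apply: SB.1.1; [exact: Su | exact: Sv]. Qed.

Lemma superpositions_comp u : S u -> S (g \o u).
Proof. by move=> Su B SB; apply: (SB.1.2 _ _).1; exact: Su. Qed.

Lemma superpositions_reflect u : S u -> S (fun x => 1 - u x / 2).
Proof. by move=> Su B SB; apply: (SB.1.2 _ _).2; exact: Su. Qed.

Lemma superpositions_two_sub u : S u -> S (fun x => 2 - u x).
Proof.
move=> Su; have Sr := superpositions_reflect Su.
have := superpositions_add Sr Sr; congr (S _).
by apply/funext => x /=; field.
Qed.

(** Reflecting 2 - u gives 1 - (2 - u) / 2 = u / 2. *)
Lemma superpositions_half u : S u -> S (fun x => u x / 2).
Proof.
move=> /superpositions_two_sub/superpositions_reflect; congr (S _).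
by apply/funext => x /=; field.
Qed.

(** The sum of u and 2 - u, where u is a coordinate: the class is generated from the
    coordinates, and 0 < n provides one. *)
Lemma superpositions_two : (0 < n)%N -> S (cst 2).
Proof.
move=> n0; have Sx := superpositions_coordinate (Ordinal n0).
have := superpositions_add Sx (superpositions_two_sub Sx); congr (S _).
by apply/funext => x /=; ring.
Qed.

Lemma superpositions_one : (0 < n)%N -> S (cst 1).
Proof.
move=> /superpositions_two/superpositions_half; congr (S _).
by apply/funext => x /=; field.
Qed.

(** Reflecting 4 gives -1, and - u is 2 - u plus twice -1. *)
Lemma superpositions_opp u : (0 < n)%N -> S u -> S (fun x => - u x).
Proof.
move=> n0 Su; have S2 := superpositions_two n0.
have Sm1 := superpositions_reflect (superpositions_add S2 S2).
have := superpositions_add (superpositions_two_sub Su) (superpositions_add Sm1 Sm1).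
by congr (S _); apply/funext => x /=; field.
Qed.

End superpositions.

Theorem theorem2p2 (R : realType) (n : nat) (n_gt0 : (0 < n)%N)
    (g1 : R -> R) (g1_cont : continuous g1) (g1_nonaffine : ~ affine g1)
    (K : set 'rV[R]_n) (K_compact : compact K)
    (f : 'rV[R]_n -> R) (f_cont : {within K, continuous f})
    (eps : R) (eps_gt0 : 0 < eps) :
  exists2 F : 'rV[R]_n -> R,
    superpositions g1 (fun t : R => 1 - t / 2) F &
    (uniform_dist K f F < eps%:E)%E.
Proof.
pose S := @superpositions R n g1 (fun t : R => 1 - t / 2).
have A_space : closed_function_space K (closure_on K S).
  apply: closure_on_space => //.
  - exact: superpositions_add.
  - by move=> u; exact: superpositions_opp.
  - exact: superpositions_half.
  - exact: superpositions_one.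
have g1_op : operates (closure_on K S) g1.
  by apply: closure_on_operates => //; exact: superpositions_comp.
have [] : closure_on K S f; last first.
  (* Pointwise strict bounds only give a weak bound on the supremum, hence half
     of eps. *)
  have e2 : 0 < eps / 2 by rewrite divr_gt0.
  move=> _ /(_ _ e2)[F SF fF]; exists F => //.
  apply: le_lt_trans (_ : ((eps / 2)%:E < _)%E); last by rewrite lte_fin; lra.
  by apply: ge_ereal_sup => _ [x Kx <-]; rewrite lee_fin ltW // fF.
apply: (operating_nonaffine_dense K_compact A_space g1_cont g1_nonaffine) => //.
move=> x y _ _ xy.
have [j xyj] : exists j, x ord0 j <> y ord0 j.
  apply: contrapT => H; apply: xy; apply/rowP => j.
  by apply: contrapT => xyj; apply: H; exists j.
exists (coordinate j) => //.
apply: sub_closure_on; first exact: superpositions_coordinate.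
by apply: continuous_subspaceT => z; exact: coord_continuous.
Qed.
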